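(* Let $\mathcal{A}$ be a unital $C^*$-algebra, let $a\in\mathcal{A}$, and let $(\sigma_\mu)_{0\le\mu\le1}$ be an interpolation path of a symmetric mean $\sigma$. Then the following hold: (i) $\|a\|_{\sigma_0}=v(a)$ and $\|a\|_{\sigma_1}=\|a\|$. (ii) For each $0\le\mu\le1$, $v(a)\le\|a\|_{\sigma_\mu}\le\|a\|$. (iii) For each $0\le\mu\le1$, $\|a\|_{\sigma_\mu}\le\sqrt{v(a)^2\,\sigma_\mu\,\|a\|^2}$. (iv) For any $\mu\in[0,1]$, $\|a\|_{\sigma_\mu}=0$ if and only if $a=0$. (v) $\|\lambda a\|_{\sigma_\mu}=|\lambda|\,\|a\|_{\sigma_\mu}$ for every $\lambda\in\mathbb{C}$ and every $\mu\in[0,1]$. (vi) If $a$ is normal, then $v(a)=\|a\|_{\sigma_\mu}=\|a^*\|_{\sigma_\mu}=\|a\|$ for every $\mu\in[0,1]$.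
   Context: $\mathcal{A}$ is a unital $C^*$-algebra with unit $1$, $\mathcal{A}'$ is its space of continuous linear functionals, and $\mathcal{S}(\mathcal{A})=\{f\in\mathcal{A}': f(1)=\|f\|=1\}$ is the set of states. The algebraic numerical radius is $v(a)=\sup\{|f(a)|: f\in\mathcal{S}(\mathcal{A})\}$. A mean is a function $\sigma:[0,\infty)\times[0,\infty)\to[0,\infty)$, written $s\,\sigma\,t=\sigma(s,t)$, such that: $\sigma(s,t)\ge0$; if $s\le t$ then $s\le\sigma(s,t)\le t$; $\sigma$ is monotone increasing in both variables; $\sigma(\alpha s,\alpha t)=\alpha\sigma(s,t)$ for $\alpha>0$; $\sigma$ is continuous. It is symmetric if $s\,\sigma\,t=t\,\sigma\,s$. An interpolation path for a symmetric mean $\sigma$ is a family of means $(\sigma_\mu)_{\mu\in[0,1]}$ such that: $s\,\sigma_0\,t=s$, $s\,\sigma_1\,t=t$, $s\,\sigma_{1/2}\,t=s\,\sigma\,t$ for all $s,t\ge0$; $(s\,\sigma_\mu\,t)\,\sigma\,(s\,\sigma_\nu\,t)=s\,\sigma_{(\mu+\nu)/2}\,t$ for all $\mu,\nu\in[0,1]$; each $\sigma_\mu$ is increasing in each of its components. For $a\in\mathcal{A}$ and $0\le\mu\le1$, $$\|a\|_{\sigma_\mu}=\sup\left\{\sqrt{|f(a)|^2\,\sigma_\mu\,f(a^*a)}: f\in\mathcal{S}(\mathcal{A})\right\}.$$ *)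

(* Defs.v *)
From HB Require Import structures.
From mathcomp Require Import all_boot all_order all_algebra.
From mathcomp Require Import complex.
From mathcomp Require Import boolp classical_sets reals topology normedtype.

Set Implicit Arguments.
Unset Strict Implicit.
Unset Printing Implicit Defensive.

Import Order.TTheory GRing.Theory Num.Theory.
Import numFieldNormedType.Exports.

Local Open Scope classical_set_scope.
Local Open Scope ring_scope.

(* Unital C*-algebras over R[i]. A structure inheriting both from the ring and
   from the normed module structures would be a second join of the two besides
   numDomainType, which Hierarchy Builder rejects. The product is therefore a
   field of the mixin, and the ring and algebra structures are instances on the
   carrier. The zero algebra, which has no states, is excluded. That `|1| = 1
   and that star is isometric follow from the C*-identity. *)
HB.mixin Record isCStarAlgebra (R : realType) A
    of CompleteNormedModule R[i] A := {
  cstar_one : A;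
  cstar_mul : A -> A -> A;
  star : A -> A;
  cstar_mulA : associative cstar_mul;
  cstar_mul1l : left_id cstar_one cstar_mul;
  cstar_mul1r : right_id cstar_one cstar_mul;
  cstar_mulDl : left_distributive cstar_mul +%R;
  cstar_mulDr : right_distributive cstar_mul +%R;
  cstar_one_neq0 : cstar_one != 0;
  cstar_scaleAl : forall (k : R[i]) (x y : A),
    k *: cstar_mul x y = cstar_mul (k *: x) y;
  cstar_scaleAr : forall (k : R[i]) (x y : A),
    k *: cstar_mul x y = cstar_mul x (k *: y);
  cstar_normM : forall x y : A, `|cstar_mul x y| <= `|x| * `|y|;
  starK : involutive star;
  starD : {morph star : x y / x + y};
  starZ : forall (k : R[i]) (x : A), star (k *: x) = k^* *: star x;
  starM : forall x y : A, star (cstar_mul x y) = cstar_mul (star y) (star x);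
  cstar_identity : forall x : A, `|cstar_mul (star x) x| = `|x| ^+ 2
}.

#[short(type="cstarAlgType")]
HB.structure Definition CStarAlgebra (R : realType) :=
  {A of isCStarAlgebra R A & CompleteNormedModule R[i] A}.

HB.instance Definition _ (R : realType) (A : cstarAlgType R) :=
  GRing.Zmodule_isNzRing.Build A (@cstar_mulA R A) (@cstar_mul1l R A)
    (@cstar_mul1r R A) (@cstar_mulDl R A) (@cstar_mulDr R A)
    (@cstar_one_neq0 R A).
#[non_forgetful_inheritance]
HB.instance Definition _ (R : realType) (A : cstarAlgType R) :=
  GRing.Lmodule_isLalgebra.Build R[i] A (@cstar_scaleAl R A).
#[non_forgetful_inheritance]
HB.instance Definition _ (R : realType) (A : cstarAlgType R) :=
  GRing.Lalgebra_isAlgebra.Build R[i] A (@cstar_scaleAr R A).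

(* The norm of a normed module over R[i] is R[i]-valued; it is nonnegative,
   hence real, and rnorm is the same number seen in R. *)
Definition rnorm (R : realType) (V : normedZmodType R[i]) (x : V) : R :=
  complex.Re `|x|.

Section States.
Variables (R : realType) (A : cstarAlgType R).

Definition functional_norm (f : A -> R[i]) : R :=
  sup [set rnorm (f x) | x in [set x : A | rnorm x <= 1]].

Definition states : set {linear A -> R[i]^o} :=
  [set f : {linear A -> R[i]^o} |
    [/\ continuous f, f (1 : A) = 1 & functional_norm f = 1]].

Definition numerical_radius (a : A) : R :=
  sup [set rnorm (f a) | f in states].

(* A state is positive, so f (star a * a) is a nonnegative real; Re reads it
   in R. *)
Definition mean_norm (sigma : R -> R -> R) (a : A) : R :=
  sup [set Num.sqrt (sigma (rnorm (f a) ^+ 2) (complex.Re (f (star a * a))))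
      | f in states].

Definition normal_element (a : A) : Prop := star a * a = a * star a.

End States.

(* Means are functions on [0, +oo[ x [0, +oo[; here they are represented by
   functions on R * R whose values outside that quadrant are irrelevant. *)
Section Means.
Variable R : realType.
Implicit Types (sigma : R -> R -> R) (sg : R -> R -> R -> R).

Definition increasing_components sigma : Prop :=
  (forall s s' t, 0 <= s -> s <= s' -> 0 <= t -> sigma s t <= sigma s' t) /\
  (forall s t t', 0 <= s -> 0 <= t -> t <= t' -> sigma s t <= sigma s t').

Record mean sigma : Prop := Mean {
  mean_ge0 : forall s t, 0 <= s -> 0 <= t -> 0 <= sigma s t;
  mean_between : forall s t, 0 <= s -> s <= t -> s <= sigma s t <= t;
  mean_increasing : increasing_components sigma;
  mean_homogeneous : forall alpha s t, 0 < alpha -> 0 <= s -> 0 <= t ->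
    sigma (alpha * s) (alpha * t) = alpha * sigma s t;
  mean_continuous :
    {within [set p : R * R | 0 <= p.1 /\ 0 <= p.2],
      continuous (fun p => sigma p.1 p.2)}
}.

Definition symmetric_mean sigma : Prop :=
  mean sigma /\ (forall s t, 0 <= s -> 0 <= t -> sigma s t = sigma t s).

Record interpolation_path sigma sg : Prop := InterpolationPath {
  path_mean : forall mu, 0 <= mu <= 1 -> mean (sg mu);
  path0 : forall s t, 0 <= s -> 0 <= t -> sg 0 s t = s;
  path1 : forall s t, 0 <= s -> 0 <= t -> sg 1 s t = t;
  path_half : forall s t, 0 <= s -> 0 <= t -> sg 2^-1 s t = sigma s t;
  path_mid : forall mu nu s t, 0 <= mu <= 1 -> 0 <= nu <= 1 ->
    0 <= s -> 0 <= t -> sigma (sg mu s t) (sg nu s t) = sg ((mu + nu) / 2) s t;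
  path_increasing : forall mu, 0 <= mu <= 1 -> increasing_components (sg mu)
}.

End Means.

(* Main.v *)
From HB Require Import structures.
Require Import Defs.
From mathcomp Require Import all_boot all_order all_algebra.
From mathcomp Require Import cyclic separable cyclotomic.
From mathcomp Require Import complex.
From mathcomp Require Import boolp classical_sets reals topology normedtype.
From mathcomp Require Import zify ring lra.

(* States come from a real Hahn-Banach theorem: a minimal sublinear functional
   is linear. Tilting the norm in the direction of 1 yields, for every b, a state
   f with Re f(b) = inf_t (|b + t| - t). If |f(a)| <= al < |a|
   for a normal a and all states f, then |w a + X| <= X + be for one X, some be < |a| and
   all |w| = 1; averaging powers of w a + X over roots of unity bounds each term
   of the expansion of (X + |a|)^m by (X + be)^m, which is absurd as m grows.
   Hence v(a) = |a| for normal a. States are also nonnegative on squares of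
   self-adjoint elements, satisfy Cauchy-Schwarz there, and by Kaplansky's
   argument are nonnegative on every a^* a. Then |f a|^2 <= f(a^* a) <= |a|^2,
   and all the claims follow from the axioms of a mean. *)

Set Implicit Arguments.
Unset Strict Implicit.
Unset Printing Implicit Defensive.

Import Order.TTheory GRing.Theory Num.Theory.
Import numFieldNormedType.Exports.

Local Open Scope ring_scope.

(** * Hahn-Banach theorem *)

Section HahnBanach.
Local Open Scope complex_scope.
Variables (R : realType) (V : lmodType R[i]).
Implicit Types (p : V -> R) (x y b : V) (r s t : R).

Record sublinear (q : V -> R) : Prop := Sublinear {
  sublinearD : forall x y, q (x + y) <= q x + q y;
  sublinearZ : forall r x, 0 <= r -> q (r%:C *: x) = r * q x
}.

Lemma sublinear0 (q : V -> R) : sublinear q -> q 0 = 0.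
Proof. by move=> sq; rewrite -(scale0r 0) (sublinearZ sq) ?mul0r. Qed.

Lemma sublinear_opp_ge (q : V -> R) x : sublinear q -> - q (- x) <= q x.
Proof.
move=> sq; have := sublinearD sq x (- x).
by rewrite subrr sublinear0// -lerBlDr sub0r.
Qed.

(* A linear functional below [tilt q b] lies below [q] and agrees with it at [b],
   by [tilt_opp]. *)
Definition tilt (q : V -> R) b x : R :=
  inf [set q (x + t%:C *: b) - t * q b | t in [set t | 0 <= t]]%classic.

Lemma tilt_ge (q : V -> R) b x z :
  (forall t, 0 <= t -> z <= q (x + t%:C *: b) - t * q b) -> z <= tilt q b x.
Proof.
move=> zle; apply: lb_le_inf; first by exists (q (x + 0%:C *: b) - 0 * q b), 0 => /=.
by move=> _ [t /= t0 <-]; exact: zle.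
Qed.

Lemma tilt_le (q : V -> R) b x t : sublinear q -> 0 <= t ->
  tilt q b x <= q (x + t%:C *: b) - t * q b.
Proof.
move=> sq t0; apply: ge_inf; last by exists t.
(* The infimum is finite: [s * q b = q (s b) <= q (x + s b) + q (- x)]. *)
exists (- q (- x)) => _ [s /= s0 <-].
rewrite -(sublinearZ sq)// lerBrDl.
have := sublinearD sq (x + s%:C *: b) (- x).
by rewrite addrAC subrr add0r; lra.
Qed.

Lemma tilt_le_self (q : V -> R) b x : sublinear q -> tilt q b x <= q x.
Proof.
move=> sq; apply: le_trans (tilt_le b x sq (lexx 0)) _.
by rewrite scale0r addr0 mul0r subr0.
Qed.

Lemma tilt_lt (q : V -> R) b x e : 0 < e ->
  exists2 t, 0 <= t & q (x + t%:C *: b) - t * q b < tilt q b x + e.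
Proof.
move=> e0; apply/not_exists2P => h.
suff : tilt q b x + e <= tilt q b x by lra.
by apply: tilt_ge => t t0; have [//|/negP] := h t; rewrite -leNgt.
Qed.

Lemma sublinear_tilt (q : V -> R) b : sublinear q -> sublinear (tilt q b).
Proof.
move=> sq; split=> [x y|r x].
  apply/ler_addgt0Pr => e e0; have e20 : 0 < e / 2 by lra.
  have [s s0 hs] := tilt_lt q b x e20; have [t t0 ht] := tilt_lt q b y e20.
  have st0 : 0 <= s + t by lra.
  apply: le_trans (tilt_le b _ sq st0) _.
  have := sublinearD sq (x + s%:C *: b) (y + t%:C *: b).
  rewrite addrACA -scalerDl -rmorphD; move: hs ht; lra.
rewrite le_eqVlt => /predU1P[<-|r0].
  rewrite scale0r mul0r; apply/eqP; rewrite eq_le; apply/andP; split.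
    by apply: le_trans (tilt_le_self _ _ sq) _; rewrite sublinear0.
  by apply: tilt_ge => t t0; rewrite add0r (@sublinearZ _ sq t)// subrr.
(* Substituting [s = r t] turns the infimum at [r x] into [r] times the infimum at [x]. *)
have scale s z : q (r%:C *: z + s%:C *: b) - s * q b =
    r * (q (z + (s / r)%:C *: b) - s / r * q b).
  rewrite mulrBr -(@sublinearZ _ sq r) ?ltW// scalerDr scalerA -rmorphM.
  rewrite [r * (s / r)]mulrC divfK ?gt_eqF//.
  by rewrite mulrA [r * (s / r)]mulrC divfK ?gt_eqF.
apply/eqP; rewrite eq_le; apply/andP; split.
  rewrite -ler_pdivrMl//; apply: tilt_ge => t t0.
  rewrite ler_pdivrMl//; have rt0 : 0 <= t * r by rewrite mulr_ge0// ltW.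
  by have := tilt_le b (r%:C *: x) sq rt0; rewrite scale mulfK ?gt_eqF.
apply: tilt_ge => t t0; rewrite scale ler_pM2l//.
by apply: tilt_le => //; rewrite divr_ge0// ltW.
Qed.

Lemma tilt_opp (q : V -> R) b : sublinear q -> tilt q b (- b) <= - q b.
Proof.
move=> sq; apply: le_trans (tilt_le b _ sq ler01) _.
by rewrite scale1r addNr sublinear0// sub0r mul1r.
Qed.

Lemma minimal_sublinear p : sublinear p -> exists q,
  [/\ sublinear q, forall x, q x <= p x &
      forall q', sublinear q' -> (forall x, q' x <= q x) -> q' = q].
Proof.
move=> sp; pose T := {q : V -> R | sublinear q /\ forall x, q x <= p x}.
have pT : sublinear p /\ forall x, p x <= p x by [].
(* The order is reversed, so that maximal elements are minimal functionals. *)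
pose le (q1 q2 : T) : bool := `[< forall x, sval q2 x <= sval q1 x >].
have lexx_ (q : T) : le q q by apply/asboolP.
have le_tr (q1 q2 q3 : T) : le q1 q2 -> le q2 q3 -> le q1 q3.
  by move=> /asboolP h1 /asboolP h2; apply/asboolP => x; exact: le_trans (h1 x).
have le_anti (q1 q2 : T) : le q1 q2 -> le q2 q1 -> q1 = q2.
  case: q1 q2 => [q1 h1] [q2 h2] /asboolP /= l1 /asboolP /= l2.
  by apply: eq_exist; apply: funext => x; apply/eqP; rewrite eq_le l1 l2.
have [C totC|[q [sq qp]] qmin] := Zorn lexx_ le_tr le_anti; last first.
  exists q; split=> // q' sq' q'q.
  have q'T : sublinear q' /\ forall x, q' x <= p x.
    by split=> // x; exact: le_trans (qp x).
  suff /(congr1 sval) : exist _ q' q'T = exist _ q (conj sq qp) :> T by [].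
  by apply: qmin; apply/asboolP.
have [[q0 Cq0]|C0] := pselect (exists q : T, C q); last first.
  by exists (exist _ p pT) => q Cq; case: C0; exists q.
pose m x := inf [set sval q x | q in C]%classic.
have mlb x (q : T) : C q -> m x <= sval q x.
  move=> Cq; apply: ge_inf; last by exists q.
  exists (- p (- x)) => _ [[q' [sq' q'p]] /= Cq' <-].
  by apply: le_trans (sublinear_opp_ge _ sq'); rewrite lerN2.
have mge x z : (forall q, C q -> z <= sval q x) -> z <= m x.
  move=> h; apply: lb_le_inf; first by exists (sval q0 x), q0.
  by move=> _ [q Cq <-]; exact: h.
have mlt x e : 0 < e -> exists2 q, C q & sval q x < m x + e.
  move=> e0; apply/not_exists2P => h; suff : m x + e <= m x by lra.
  by apply: mge => q Cq; have [//|/negP] := h q; rewrite -leNgt.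
have sm : sublinear m.
  split=> [x y|r x r0].
    apply/ler_addgt0Pr => e e0; have e20 : 0 < e / 2 by lra.
    have [q1 C1 h1] := mlt x _ e20; have [q2 C2 h2] := mlt y _ e20.
    (* The smaller of two chain members is nearly optimal at both points. *)
    have [q [Cq l1 l2]] : exists q : T, [/\ C q, sval q x <= sval q1 x & sval q y <= sval q2 y].
      by have [/asboolP l|/asboolP l] := totC _ _ C1 C2; [exists q2|exists q1].
    apply: le_trans (mlb _ _ Cq) _; apply: le_trans (sublinearD (svalP q).1 _ _) _.
    by move: l1 l2 h1 h2; lra.
  apply/eqP; rewrite eq_le; apply/andP; split; last first.
    apply: mge => q Cq; rewrite (sublinearZ (svalP q).1)//.
    by apply: ler_wpM2l => //; exact: mlb.
  move: r0; rewrite [0 <= r]le_eqVlt => /predU1P[<-|r0].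
    by rewrite scale0r mul0r (le_trans (mlb _ _ Cq0))// sublinear0//; exact: (svalP q0).1.
  rewrite -ler_pdivrMl//; apply: mge => q Cq; rewrite ler_pdivrMl//.
  by rewrite -(@sublinearZ _ (svalP q).1 r); [exact: mlb Cq|exact: ltW].
have mT : sublinear m /\ forall x, m x <= p x.
  by split=> // x; exact: le_trans (mlb _ _ Cq0) ((svalP q0).2 x).
by exists (exist _ m mT) => q Cq; apply/asboolP => x; exact: mlb.
Qed.

(* A minimal sublinear functional equals all its tilts, hence is additive. *)
Lemma real_Hahn_Banach p : sublinear p -> exists u : V -> R,
  [/\ {morph u : x y / x + y}, forall r x, u (r%:C *: x) = r * u x
    & forall x, u x <= p x].
Proof.
move=> sp; have [q [sq qp qmin]] := minimal_sublinear sp.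
have qD : {morph q : x y / x + y}.
  move=> x y; apply/eqP; rewrite eq_le (sublinearD sq) /=.
  have <- := congr1 (fun q' => q' x)
    (qmin _ (sublinear_tilt y sq) (fun z => tilt_le_self y z sq)).
  have := tilt_le y x sq ler01; rewrite scale1r mul1r.
  lra.
exists q; split=> // r x.
have qN z : q (- z) = - q z.
  by have := qD z (- z); rewrite subrr sublinear0//; lra.
have [r0|/ltW r0] := leP 0 r; first exact: sublinearZ sq _ _ r0.
have := sublinearZ sq x (etrans (oppr_ge0 r) r0).
by rewrite rmorphN scaleNr qN mulNr => /oppr_inj.
Qed.

(** The functional [u x - i u (i x)] has real part [u]; choosing [u] below the tilt of [p] at [b],
    not merely below [p], makes the bound attained at [b]. *)
Lemma complex_Hahn_Banach p b : sublinear p -> exists f : {linear V -> R[i]^o},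
  (forall x, complex.Re (f x) <= p x) /\ complex.Re (f b) = p b.
Proof.
move=> sp; have [u [uD uZ up]] := real_Hahn_Banach (sublinear_tilt b sp).
have u0 : u 0 = 0 by have := uD 0 0; rewrite addr0; lra.
have uN x : u (- x) = - u x by have := uD x (- x); rewrite subrr u0; lra.
pose f x : R[i]^o := u x -i* u ('i *: x).
have f_lin : linear f.
  move=> k x y; rewrite /f; apply/eqP.
  have -> : k = (complex.Re k)%:C + (complex.Im k)%:C * 'i by rewrite {1}[k]complexE mulrC.
  set r := complex.Re k; set s := complex.Im k.
  have -> : 'i *: ((r%:C + s%:C * 'i) *: x + y) =
      r%:C *: ('i *: x) - s%:C *: x + 'i *: y.
    rewrite scalerDr scalerA mulrDr (mulrCA 'i) -expr2 sqr_i mulrN1.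
    by rewrite scalerDl scaleNr ['i * r%:C]mulrC -scalerA.
  rewrite scalerDl -scalerA !(uD, uN, uZ) eq_complex /=.
  by apply/andP; split; apply/eqP; ring.
pose F : {linear V -> R[i]^o} :=
  HB.pack f (GRing.isLinear.Build _ _ _ _ f f_lin).
exists F; split=> [x|].
  by rewrite /=; apply: le_trans (up x) _; exact: tilt_le_self.
apply/eqP; rewrite eq_le; apply/andP; split.
  by rewrite /=; apply: le_trans (up b) _; exact: tilt_le_self.
rewrite /= -lerN2 -uN; apply: le_trans (up _) _; exact: tilt_opp.
Qed.

End HahnBanach.

(** * Real-valued norms and states *)

Section Rnorm.
Local Open Scope complex_scope.
Variables (R : realType) (V : normedZmodType R[i]).
Implicit Types (x y : V).

Lemma rnormE x : `|x| = (rnorm x)%:C.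
Proof. by rewrite /rnorm RRe_real// normr_real. Qed.

Lemma rnorm_ge0 x : 0 <= rnorm x.
Proof. by rewrite -ler0c -rnormE. Qed.

Lemma rnorm_eq0 x : (rnorm x == 0) = (x == 0).
Proof. by rewrite -(inj_eq (@complexI R)) -rnormE normr_eq0. Qed.

Lemma rnorm0 : rnorm (0 : V) = 0.
Proof. by apply/eqP; rewrite rnorm_eq0. Qed.

Lemma ler_rnormD x y : rnorm (x + y) <= rnorm x + rnorm y.
Proof. by rewrite -lecR rmorphD /= -!rnormE ler_normD. Qed.

Lemma rnormN x : rnorm (- x) = rnorm x.
Proof. by rewrite /rnorm normrN. Qed.

Lemma ler_rnorm_sum (I : Type) (s : seq I) (F : I -> V) :
  rnorm (\sum_(i <- s) F i) <= \sum_(i <- s) rnorm (F i).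
Proof.
elim/big_rec2: _ => [|i y z _ h]; first by rewrite rnorm0.
by apply: le_trans (ler_rnormD _ _) _; rewrite lerD2l.
Qed.

End Rnorm.

Section RnormComplex.
Local Open Scope complex_scope.
Variable R : realType.
Implicit Types (z w : R[i]) (r : R).

Lemma rnormC z : rnorm z = Num.sqrt (complex.Re z ^+ 2 + complex.Im z ^+ 2).
Proof. by rewrite /rnorm normc_def. Qed.

Lemma sqr_rnormC z : rnorm z ^+ 2 = complex.Re z ^+ 2 + complex.Im z ^+ 2.
Proof. by rewrite rnormC sqr_sqrtr// addr_ge0// sqr_ge0. Qed.

Lemma rnorm_real r : rnorm r%:C = `|r|.
Proof. by rewrite rnormC /= expr0n addr0 sqrtr_sqr. Qed.

Lemma rnormCM z w : rnorm (z * w) = rnorm z * rnorm w.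
Proof. by apply: (@complexI R); rewrite rmorphM /= -!rnormE normrM. Qed.

Lemma rnormCX z n : rnorm (z ^+ n) = rnorm z ^+ n.
Proof. by apply: (@complexI R); rewrite rmorphXn /= -!rnormE normrX. Qed.

Lemma normr_Re_le z : `|complex.Re z| <= rnorm z.
Proof. by rewrite -lecR -rnormE normc_ge_Re. Qed.

Lemma Re_le_rnorm z : complex.Re z <= rnorm z.
Proof. exact: le_trans (ler_norm _) (normr_Re_le z). Qed.

Lemma rnormZ (V : normedModType R[i]) z (x : V) :
  rnorm (z *: x) = rnorm z * rnorm x.
Proof. by apply: (@complexI R); rewrite rmorphM /= -!rnormE normrZ. Qed.

Lemma sublinear_rnorm (V : normedModType R[i]) : sublinear (@rnorm R V).
Proof.
split=> [x y|r x r0]; first exact: ler_rnormD.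
by rewrite rnormZ rnorm_real ger0_norm.
Qed.

End RnormComplex.

(** * The norm of a C*-algebra, and states as unital contractions *)

Section CStarBasics.
Local Open Scope complex_scope.
Variables (R : realType) (A : cstarAlgType R).
Implicit Types (x y : A) (k : R[i]) (r : R).

Lemma starZc k x : star (k *: x) = conjc k *: star x.
Proof. exact: starZ. Qed.

Lemma starZr r x : star (r%:C *: x) = r%:C *: star x.
Proof. by rewrite starZc conjc_real. Qed.

Lemma starMr x y : star (x * y) = star y * star x.
Proof. exact: starM. Qed.

Lemma star0 : star (0 : A) = 0.
Proof. by have := starZc 0 (0 : A); rewrite conjc0 !scale0r. Qed.

Lemma star1 : star (1 : A) = 1.
Proof. by have := starMr (star 1) 1; rewrite starK !mulr1 starK. Qed.

Lemma starN x : star (- x) = - star x.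
Proof. by apply/eqP; rewrite -addr_eq0 -starD addNr star0. Qed.

Lemma rnormM_le x y : rnorm (x * y) <= rnorm x * rnorm y.
Proof. by rewrite -lecR rmorphM /= -!rnormE; exact: cstar_normM. Qed.

Lemma rnorm_starM x : rnorm (star x * x) = rnorm x ^+ 2.
Proof.
by apply: (@complexI R); rewrite rmorphXn /= -!rnormE; exact: cstar_identity.
Qed.

(** Cancel [|y|] in [|y|^2 = |y^* y| <= |y^*| |y|], then exchange [y] and [y^*]. *)
Lemma rnorm_star x : rnorm (star x) = rnorm x.
Proof.
have le y : rnorm y <= rnorm (star y).
  have [->|y0] := eqVneq y 0; first by rewrite star0.
  have y_gt0 : 0 < rnorm y by rewrite lt0r rnorm_eq0 y0 rnorm_ge0.
  rewrite -(ler_pM2r y_gt0) -expr2 -rnorm_starM; exact: rnormM_le.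
by apply/eqP; rewrite eq_le le -{2}[x]starK le.
Qed.

Lemma rnorm1 : rnorm (1 : A) = 1.
Proof.
have n0 : rnorm (1 : A) != 0 by rewrite rnorm_eq0 oner_neq0.
by apply: (mulfI n0); rewrite mulr1 -expr2 -rnorm_starM star1 mulr1.
Qed.

Lemma rnormX_le x n : rnorm (x ^+ n) <= rnorm x ^+ n.
Proof.
elim: n => [|n IH]; first by rewrite !expr0 rnorm1.
rewrite !exprS; apply: le_trans (rnormM_le _ _) _.
by rewrite ler_wpM2l ?rnorm_ge0.
Qed.

Lemma starX x n : star (x ^+ n) = star x ^+ n.
Proof.
by elim: n => [|n IH]; rewrite ?expr0 ?star1// exprS starMr IH -exprSr.
Qed.

(* A normal element satisfies [|x^2| = |x|^2]; iterating gives the powers [2^k],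
   and submultiplicativity the others. *)
Lemma normal_rnormX x n : normal_element x -> rnorm (x ^+ n) = rnorm x ^+ n.
Proof.
(* By the C*-identity the squares of both sides are the norms of [(y^2)^* y^2] and
   [(y^* y)^* (y^* y)], which agree by normality. *)
move=> nx; have comm y : normal_element y -> rnorm (y ^+ 2) = rnorm y ^+ 2.
  move=> ny; apply/eqP.
  rewrite -(@eqrXn2 _ 2)// ?exprn_ge0 ?rnorm_ge0//; apply/eqP.
  rewrite -(rnorm_starM y) -(rnorm_starM (y ^+ 2)) -(rnorm_starM (star y * y)).
  congr rnorm; rewrite starX starMr starK !expr2 -!mulrA; congr (_ * _).
  by rewrite !mulrA; congr (_ * _); exact: ny.
have nX (k : nat) : normal_element (x ^+ k).
  rewrite /normal_element starX; apply: commrX; apply: commr_sym.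
  by apply: commrX; apply: commr_sym; exact: nx.
have pow2 (k : nat) : rnorm (x ^+ (2 ^ k)) = rnorm x ^+ (2 ^ k).
  by elim: k => [|k IH]; rewrite ?expn0 ?expr1// expnSr !exprM comm ?IH.
have [->|x0] := eqVneq x 0.
  by case: n => [|n]; rewrite ?expr0 ?rnorm1// rnorm0 !expr0n /= rnorm0.
have xp : 0 < rnorm x by rewrite lt0r rnorm_eq0 x0 rnorm_ge0.
apply/eqP; rewrite eq_le rnormX_le /=.
have le_n : (n <= 2 ^ n)%N by rewrite ltnW// ltn_expl.
(* Compare with the exponent [2^n >= n], where equality is known. *)
rewrite -(ler_pM2r (exprn_gt0 (2 ^ n - n)%N xp)) -exprD subnKC// -pow2.
rewrite -{1}(subnKC le_n) exprD; apply: le_trans (rnormM_le _ _) _.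
by rewrite ler_wpM2l ?rnorm_ge0// rnormX_le.
Qed.

Lemma state1 (f : {linear A -> R[i]^o}) : states f -> f 1 = 1.
Proof. by case. Qed.

Lemma state_le (f : {linear A -> R[i]^o}) x : states f -> rnorm (f x) <= rnorm x.
Proof.
case=> fc f1 fn; have [->|x0] := eqVneq x 0; first by rewrite linear0 !rnorm0.
have xp : 0 < rnorm x by rewrite lt0r rnorm_eq0 x0 rnorm_ge0.
(* On an unbounded set [sup] defaults to 0, so the value 1 of the functional norm certifies
   boundedness. *)
have [S_sup|S_sup] := pselect (has_sup
    [set rnorm (f x) | x in [set x : A | rnorm x <= 1]]%classic); last first.
  by move: fn; rewrite /functional_norm sup_out// => /esym /eqP; rewrite oner_eq0.
have xi0 : 0 <= (rnorm x)^-1 by rewrite invr_ge0 ltW.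
have : rnorm (f ((rnorm x)^-1%:C *: x)) <= 1.
  rewrite -fn; apply: ub_le_sup; first by case: S_sup.
  exists ((rnorm x)^-1%:C *: x) => //=.
  by rewrite rnormZ rnorm_real ger0_norm// mulVf// gt_eqF.
by rewrite linearZ /= rnormZ rnorm_real ger0_norm// ler_pdivrMl// mulr1.
Qed.

Lemma stateP (f : {linear A -> R[i]^o}) :
  f 1 = 1 -> (forall x, rnorm (f x) <= rnorm x) -> states f.
Proof.
move=> f1 fle; split=> //.
  move=> x; apply: bounded_linear_continuous; apply/linear_boundedP.
  exists 1; split; first by rewrite realE ler01.
  move=> r r1 y; rewrite !rnormE.
  (* In the order of [R[i]], [1 < r] forces [r] to be real. *)
  have r0 : 0 <= r by apply: le_trans (ltW r1).
  have -> : r = (complex.Re r)%:C by rewrite RRe_real// realE r0.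
  rewrite -rmorphM lecR; apply: le_trans (fle y) _.
  rewrite ler_peMl ?rnorm_ge0//.
  by move: r1; rewrite ltcE => /andP[_ /ltW].
apply/eqP; rewrite eq_le; apply/andP; split.
  apply: ge_sup; first by exists (rnorm (f 0)), 0; rewrite //= rnorm0.
  by move=> _ [x /= x1 <-]; exact: le_trans (fle x) x1.
apply: ub_le_sup; first by exists 1 => _ [x /= x1 <-]; exact: le_trans (fle x) x1.
by exists 1; rewrite /= ?rnorm1// f1 (rnorm_real 1) normr1.
Qed.

(* Tilting the norm in the direction 1 forces the functional to be unital. *)
Lemma exists_state x : exists2 f : {linear A -> R[i]^o}, states f &
  complex.Re (f x) = tilt (@rnorm R A) 1 x.
Proof.
have sr := sublinear_rnorm A.
have [f [fle fx]] := complex_Hahn_Banach x (sublinear_tilt 1 sr).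
have Re_le y : complex.Re (f y) <= rnorm y.
  by apply: le_trans (fle y) _; exact: tilt_le_self.
have f_le y : rnorm (f y) <= rnorm y.
  have [fy0|fy0] := eqVneq (f y) 0; first by rewrite fy0 rnorm0 rnorm_ge0.
  have fyp : 0 < rnorm (f y) by rewrite lt0r rnorm_eq0 fy0 rnorm_ge0.
  (* Rotating [y] by the conjugate of [f y] upgrades the bound on the real part to one on the
     modulus. *)
  have := Re_le (conjc (f y) *: y).
  rewrite linearZ /= rnormZ [rnorm _^*]rnormC.
  have -> : complex.Re (conjc (f y) *: f y) = rnorm (f y) ^+ 2.
    by rewrite sqr_rnormC; case: (f y) => u v /=; ring.
  have -> : Num.sqrt (complex.Re (f y)^* ^+ 2 + complex.Im (f y)^* ^+ 2) = rnorm (f y).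
    by rewrite rnormC; case: (f y) => u v /=; rewrite sqrrN.
  by rewrite expr2 ler_pM2l.
exists f; last by [].
(* The tilt at [- 1] is at most [- |1|], so [Re (f 1) >= 1]; then [|f 1| <= 1] leaves no imaginary
   part. *)
apply: stateP => //; have Re1 : complex.Re (f 1) = 1.
  apply/eqP; rewrite eq_le -{1}rnorm1 Re_le /= -lerN2.
  have := le_trans (fle (- 1)) (tilt_opp 1 sr).
  by rewrite linearN rnorm1; case: (f 1).
have : rnorm (f 1) ^+ 2 <= 1 by rewrite expr_le1 ?rnorm_ge0// -rnorm1.
rewrite sqr_rnormC; move: Re1; case: (f 1) => u v /= ->.
rewrite expr1n gerDl => v2; suff -> : v = 0 by [].
by apply/eqP; rewrite -sqrf_eq0 eq_le v2 sqr_ge0.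
Qed.

End CStarBasics.

(** * States of normal elements *)

Section Growth.
Local Open Scope complex_scope.
Variable R : realType.
Implicit Types (x y h c : R).

Lemma bernoulli_ineq h n : 0 <= h -> 1 + n%:R * h <= (1 + h) ^+ n.
Proof.
move=> h0; elim: n => [|n IH]; first by rewrite mul0r addr0 expr0.
rewrite exprS; apply: (@le_trans _ _ ((1 + h) * (1 + n%:R * h))).
  rewrite -natr1; have : 0 <= n%:R * h * h by rewrite !mulr_ge0.
  nra.
by rewrite ler_wpM2l// addr_ge0.
Qed.

Lemma exists_natr_gt x : exists n : nat, x < n%:R.
Proof. by exists (Num.truncn x).+1; exact: truncnS_gt. Qed.

Lemma exp2_bounded_le1 x c : (forall n, x ^+ (2 ^ n) <= c) -> x <= 1.
Proof.
move=> xc; rewrite leNgt; apply/negP => x1; have h0 : 0 < x - 1 by lra.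
have [n hn] := exists_natr_gt (c / (x - 1)).
have := bernoulli_ineq (2 ^ n) (ltW h0); rewrite subrKC => h.
have := le_trans h (xc n); move: hn; rewrite ltr_pdivrMr// => hn.
suff : n%:R * (x - 1) <= (2 ^ n)%:R * (x - 1) by lra.
by rewrite ler_pM2r// ler_nat ltnW// ltn_expl.
Qed.

(** If [x = (1 + h) y] with [h > 0], the square of Bernoulli's inequality at exponent [k] makes
    [(1 + h)^(2k)] grow at least quadratically in [k], against the linear [2k + 1]. *)
Lemma le_of_exp_le_linear x y : 0 <= x -> 0 <= y ->
  (forall m, x ^+ m <= m.+1%:R * y ^+ m) -> x <= y.
Proof.
move=> x0 y0 xy; rewrite leNgt; apply/negP => yx.
have yp : 0 < y.
  by rewrite lt0r y0 andbT; apply/eqP => yz; have := xy 1%N; rewrite yz !expr1; lra.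
pose h := x / y - 1; have h0 : 0 < h by rewrite subr_gt0 ltr_pdivlMr// mul1r.
(* Then [k h^2 > 2], so [(k h)^2] exceeds [2k]. *)
have [k hk] := exists_natr_gt (2 / h ^+ 2).
have hh : 0 < h ^+ 2 by rewrite exprn_gt0.
move: hk; rewrite ltr_pdivrMr// => hk.
have k0 : 0 < k%:R :> R.
  by rewrite lt0r ler0n andbT; apply/eqP => kz; move: hk; rewrite kz; lra.
have up : (1 + h) ^+ (k * 2) <= (k * 2).+1%:R.
  rewrite /h subrKC exprMn exprVn ler_pdivrMr ?exprn_gt0//; exact: xy.
have lo := bernoulli_ineq k (ltW h0).
have : (1 + k%:R * h) ^+ 2 <= (k * 2).+1%:R.
  apply: le_trans up; rewrite exprM lerXn2r ?nnegrE ?exprn_ge0//; last lra.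
  by rewrite addr_ge0// mulr_ge0// ltW.
rewrite -natr1 natrM.
have -> : (1 + k%:R * h) ^+ 2 = 1 + 2 * (k%:R * h) + k%:R * (k%:R * h ^+ 2) by ring.
have : 0 < k%:R * h by rewrite mulr_gt0.
have : k%:R * 2 < k%:R * (k%:R * h ^+ 2) by rewrite ltr_pM2l.
lra.
Qed.

End Growth.

(** * Roots of unity and a finite net of the unit disc *)

Section RootsOfUnity.
Local Open Scope complex_scope.
Variable R : realType.
Implicit Types (w z : R[i]).

(** [X^n - 1] splits over the closed field [R[i]] and is separable in characteristic 0, so it has
    [n] distinct roots. *)
Lemma exists_prim_root n : (n > 0)%N -> exists z : R[i], n.-primitive_root z.
Proof.
move=> n_gt0; pose p : {poly R[i]} := 'X^n - 1.
have [r Dp] := closed_field_poly_normal p.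
rewrite (monicP _) ?monicXnsubC// scale1r in Dp.
have rn1 : all n.-unity_root r by apply/allP=> z; rewrite -root_prod_XsubC -Dp.
have sz_r : (n < (size r).+1)%N.
  by rewrite -(size_prod_XsubC r id) -Dp size_XnsubC.
have [|z] := hasP (has_prim_root n_gt0 rn1 _ sz_r); last by exists z.
by rewrite -separable_prod_XsubC -Dp separable_Xn_sub_1// pnatr_eq0 -lt0n.
Qed.

Lemma rnorm_prim_root n z : n.-primitive_root z -> rnorm z = 1.
Proof.
move=> pz; have n0 := prim_order_gt0 pz; apply/eqP.
rewrite -(@eqrXn2 _ n)// ?rnorm_ge0// -rnormCX prim_expr_order// expr1n.
by rewrite (rnorm_real 1) normr1.
Qed.

Lemma sum_prim_root n z k : n.-primitive_root z ->
  \sum_(j < n) z ^+ (j * k) = if (n %| k)%N then n%:R else 0.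
Proof.
move=> pz; under eq_bigr do rewrite mulnC exprM.
have [dv|ndv] := ifP.
  move: dv; rewrite (prim_order_dvd pz) => /eqP ->.
  rewrite (eq_bigr (fun=> 1)) => [|i _]; last by rewrite expr1n.
  by rewrite sumr_const card_ord.
have zk : z ^+ k - 1 != 0 by rewrite subr_eq0 -(prim_order_dvd pz) ndv.
apply: (mulfI zk); rewrite -subrX1 mulr0 -exprM mulnC exprM.
by rewrite (prim_expr_order pz) expr1n subrr.
Qed.

(** A square grid of step [1/n < d/2] on [[-1, 1]^2]; each coordinate contributes an error of at
    most [d/2]. *)
Lemma disc_net (d : R) : 0 < d -> exists s : seq R[i],
  forall z, rnorm z <= 1 -> exists2 w, w \in s & rnorm (z - w) <= d.
Proof.
move=> d0; have [n hn] := exists_natr_gt (2 / d).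
have n0 : 0 < n%:R :> R by apply: lt_trans hn; rewrite divr_gt0.
pose g (k : nat) : R := k%:R / n%:R - 1.
exists [seq g k +i* g l | k <- iota 0 (n * 2).+1, l <- iota 0 (n * 2).+1] => z z1.
have near u : `|u| <= 1 -> exists2 k, k \in iota 0 (n * 2).+1 & `|u - g k| <= d / 2.
  rewrite ler_norml => /andP[u1 u2].
  have un0 : 0 <= (u + 1) * n%:R by rewrite mulr_ge0//; lra.
  have := truncn_itv un0; set k := Num.truncn _ => /andP[k1 k2].
  exists k.
    rewrite mem_iota /= add0n ltnS -(ler_nat R) natrM.
    by apply: le_trans k1 _; nra.
  have nd : n%:R^-1 <= d / 2.
    rewrite -[_ / 2]invrK lef_pV2 ?posrE ?invr_gt0//; last lra.
    by rewrite invfM invrK mulrC ltW.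
  rewrite /g; have -> : u - (k%:R / n%:R - 1) = ((u + 1) * n%:R - k%:R) / n%:R.
    by field; rewrite gt_eqF.
  rewrite normrM (@ger0_norm _ n%:R^-1) ?invr_ge0//; apply: le_trans nd.
  rewrite ler_piMl ?invr_ge0// ler_norml; apply/andP; split; first lra.
  by move: k2; rewrite -natr1; lra.
have [k ks hk] := near (complex.Re z) (le_trans (normr_Re_le z) z1).
have Imz : `|complex.Im z| <= rnorm z.
  by rewrite -[`|_|]sqrtr_sqr rnormC ler_wsqrtr// lerDr sqr_ge0.
have [l ls hl] := near (complex.Im z) (le_trans Imz z1).
exists (g k +i* g l); first by apply/allpairsP; exists (k, l).
have -> : z - (g k +i* g l) =
    (complex.Re z - g k)%:C + 'i * (complex.Im z - g l)%:C.
  rewrite [z in LHS]complexE; apply/eqP; rewrite eq_complex /=.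
  by apply/andP; split; apply/eqP; ring.
apply: le_trans (ler_rnormD _ _) _; rewrite rnormCM !rnorm_real.
have -> : rnorm 'i = 1 :> R by rewrite rnormC /= expr0n expr1n add0r sqrtr1.
by rewrite mul1r; lra.
Qed.

End RootsOfUnity.

(** * Norms of shifts and states nearly attaining the norm of a normal element *)

Section NormalStates.
Local Open Scope complex_scope.
Variables (R : realType) (A : cstarAlgType R).
Implicit Types (a x y : A) (k w z : R[i]) (X M al be : R).

(** Thus [|y + X| - X] is nonincreasing in [X], and a bound found at one shift persists at all
    larger ones. *)
Lemma shift_rnorm y X X' : X <= X' ->
  rnorm (y + X'%:C *: 1) <= rnorm (y + X%:C *: 1) + (X' - X).
Proof.
move=> XX'; have -> : y + X'%:C *: 1 = (y + X%:C *: 1) + (X' - X)%:C *: 1.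
  by rewrite -addrA -scalerDl -rmorphD; congr (_ + _ %:C *: _); ring.
apply: le_trans (ler_rnormD _ _) _; rewrite lerD2l.
by rewrite rnormZ rnorm_real rnorm1 mulr1 ger0_norm// subr_ge0.
Qed.

(** Some state [f] has [Re f (w a)] equal to the infimum over [t >= 0] of [|w a + t| - t], so this
    infimum is at most [|w| al]. *)
Lemma shift_bound a al w e :
  (forall f : {linear A -> R[i]^o}, states f -> rnorm (f a) <= al) -> 0 < e ->
  exists2 X, 0 <= X & rnorm (w *: a + X%:C *: 1) <= X + rnorm w * al + e.
Proof.
move=> fal e0; have [f sf fE] := exists_state (w *: a).
have [X X0] := tilt_lt (@rnorm R A) 1 (w *: a) e0.
rewrite -fE rnorm1 mulr1 => h; exists X => //.
have := Re_le_rnorm (f (w *: a)); rewrite linearZ /= rnormCM.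
have := ler_wpM2l (rnorm_ge0 w) (fal f sf); rewrite linearZ /= in h.
by move: h; set u := complex.Re _; lra.
Qed.

(** A single shift serves a finite net of the disc, by taking the largest one; other [w] are reached
    by continuity. *)
Lemma uniform_shift_bound a al be :
  (forall f : {linear A -> R[i]^o}, states f -> rnorm (f a) <= al) ->
  0 <= al -> al < be ->
  exists2 X, 0 <= X & forall w, rnorm w = 1 ->
    rnorm (w *: a + X%:C *: 1) <= X + be.
Proof.
move=> fal al0 albe; pose M := rnorm a.
have M0 : 0 <= M := rnorm_ge0 a.
pose e := (be - al) / 2; have e0 : 0 < e by rewrite /e; lra.
(* Passing from the net to [z] costs [d M], and [|w| <= 1 + d] costs [d al]; together at most [e],
   and [al + 2 e = be]. *)
pose d := e / (M + al + 1); have d0 : 0 < d by rewrite divr_gt0//; lra.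
have [s sd] := disc_net d0.
have [X X0 hX] : exists2 X, 0 <= X & forall w, w \in s ->
    rnorm (w *: a + X%:C *: 1) <= X + rnorm w * al + e.
  elim: s {sd} => [|w s [X X0 hX]]; first by exists 0.
  have [Y Y0 hY] := shift_bound w fal e0.
  exists (Num.max X Y); first by rewrite le_max X0.
  have XZ : X <= Num.max X Y by rewrite le_max lexx.
  have YZ : Y <= Num.max X Y by rewrite le_max lexx orbT.
  move=> z; rewrite inE => /predU1P[->|zs].
    by apply: le_trans (shift_rnorm _ YZ) _; move: hY; lra.
  by apply: le_trans (shift_rnorm _ XZ) _; move: (hX _ zs); lra.
exists X => // z z1.
have [w ws hw] : exists2 w, w \in s & rnorm (z - w) <= d by apply: sd; rewrite z1.
have w_le : rnorm w <= 1 + d.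
  have -> : w = z - (z - w) by rewrite subKr.
  by apply: le_trans (ler_rnormD _ _) _; rewrite z1 rnormN lerD2l.
have -> : z *: a + X%:C *: 1 = (w *: a + X%:C *: 1) + (z - w) *: a.
  by rewrite addrAC -scalerDl subrKC.
apply: le_trans (ler_rnormD _ _) _; rewrite rnormZ -/M.
have h1 := hX w ws; have h2 := ler_wpM2r M0 hw; have h3 := ler_wpM2r al0 w_le.
have de : d * (M + al + 1) = e by rewrite divfK// gt_eqF//; lra.
have e2 : 2 * e = be - al by rewrite /e; field.
by move: h1 h2 h3 de; lra.
Qed.

(* Averaging [(z a + X)^m] over the roots of unity [z] isolates one term of
   the binomial expansion. *)
Lemma shift_coef_bound a X be m n : 0 <= X ->
  (forall w, rnorm w = 1 -> rnorm (w *: a + X%:C *: 1) <= X + be) ->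
  (n <= m)%N -> X ^+ (m - n) * rnorm (a ^+ n) *+ 'C(m, n) <= (X + be) ^+ m.
Proof.
move=> X0 hX nm; have [z pz] := exists_prim_root R (ltn0Sn m).
have z1 := rnorm_prim_root pz.
have zX (k : nat) : rnorm (z ^+ k) = 1 by rewrite rnormCX z1 expr1n.
(* The weight turns the term of degree [i] into a sum of [z^(j (m + 1 - n + i))], which vanishes
   unless [m + 1] divides [m + 1 - n + i]. As this number lies between 1 and [2m + 1], only [i = n]
   survives. *)
pose S := \sum_(j < m.+1) z ^+ (j * (m.+1 - n)) *: (z ^+ j *: a + X%:C *: 1) ^+ m.
have S_le : rnorm S <= m.+1%:R * (X + be) ^+ m.
  apply: le_trans (ler_rnorm_sum _ _) _.
  have -> : m.+1%:R * (X + be) ^+ m = \sum_(j < m.+1) (X + be) ^+ m.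
    by rewrite sumr_const card_ord mulr_natl.
  apply: ler_sum => j _.
  rewrite rnormZ zX mul1r; apply: le_trans (rnormX_le _ _) _.
  have h := hX _ (zX j).
  by rewrite lerXn2r ?nnegrE ?rnorm_ge0// (le_trans _ h) ?rnorm_ge0.
have SE : S = (m.+1%:R * (X ^+ (m - n) *+ 'C(m, n)))%:C *: a ^+ n.
  have term (j : 'I_m.+1) : z ^+ (j * (m.+1 - n)) *: (z ^+ j *: a + X%:C *: 1) ^+ m =
      \sum_(i < m.+1) (z ^+ (j * (m.+1 - n + i)) * (X ^+ (m - i) *+ 'C(m, i))%:C) *: a ^+ i.
    rewrite addrC exprDn_comm; last first.
      by rewrite /GRing.comm -!scalerAl mul1r -scalerAr mulr1 !scalerA mulrC.
    rewrite scaler_sumr; apply: eq_bigr => i _.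
    rewrite !exprZn expr1n -scalerAl mul1r -exprM scalerA -scaler_nat !scalerA.
    by congr (_ *: _); rewrite rmorphMn rmorphXn /= mulnDr exprD -mulr_natl; ring.
  rewrite /S (eq_bigr _ (fun j _ => term j)) exchange_big /=.
  have sumE (i : 'I_m.+1) :
      \sum_(j < m.+1) (z ^+ (j * (m.+1 - n + i)) * (X ^+ (m - i) *+ 'C(m, i))%:C) *: a ^+ i
      = ((if i == n :> nat then m.+1%:R else 0) * (X ^+ (m - i) *+ 'C(m, i))%:C) *: a ^+ i.
    rewrite -scaler_suml -mulr_suml (sum_prim_root _ pz).
    suff -> : (m.+1 %| m.+1 - n + i)%N = (i == n :> nat) by [].
    have [->|ni] := eqVneq (i : nat) n; first by rewrite subnK ?dvdnn ?eqxx// leqW.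
    apply/negbTE/negP => /dvdnP[q]; have := ltn_ord i.
    by move: ni nm; case: q => [|[|q]]; rewrite ?mulSn; lia.
  rewrite (eq_bigr _ (fun i _ => sumE i)) (bigD1 (Ordinal (nm : n < m.+1)%N))//= eqxx.
  rewrite big1 ?addr0; last first.
    by move=> i; rewrite -(inj_eq val_inj) /= => /negbTE ->; rewrite mul0r scale0r.
  by rewrite rmorphM rmorph_nat.
move: S_le; rewrite SE rnormZ rnorm_real ger0_norm; last first.
  by rewrite mulr_ge0// mulrn_wge0// exprn_ge0.
by rewrite -mulrA ler_pM2l// mulrnAl.
Qed.

Lemma normal_state_gt a e : normal_element a -> 0 < e ->
  exists2 f : {linear A -> R[i]^o}, states f & rnorm a - e < rnorm (f a).
Proof.
move=> na e0; apply/not_exists2P => H.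
have fal (f : {linear A -> R[i]^o}) : states f -> rnorm (f a) <= rnorm a - e.
  by move=> sf; have [//|/negP] := H f; rewrite -leNgt.
have al0 : 0 <= rnorm a - e.
  by have [f sf _] := exists_state a; exact: le_trans (rnorm_ge0 _) (fal f sf).
have albe : rnorm a - e < rnorm a - e / 2 by lra.
have [X X0 hX] := uniform_shift_bound fal al0 albe.
suff : X + rnorm a <= X + (rnorm a - e / 2) by lra.
have M0 := rnorm_ge0 a.
apply: le_of_exp_le_linear; [lra|lra|move=> m].
set y := X + (rnorm a - e / 2).
have -> : m.+1%:R * y ^+ m = \sum_(j < m.+1) y ^+ m.
  by rewrite sumr_const card_ord mulr_natl.
rewrite exprDn.
(* Normality enters here: [|a|^i = |a^i|], so each of the [m + 1] binomial terms obeys the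
   coefficient bound. *)
apply: ler_sum => i _; rewrite -(normal_rnormX _ na).
by apply: shift_coef_bound => //; rewrite -ltnS.
Qed.

End NormalStates.

(** * Self-adjoint elements *)

Section SelfAdjoint.
Local Open Scope complex_scope.
Variables (R : realType) (A : cstarAlgType R).
Implicit Types (a h x y : A) (k : nat) (r t : R) (p q : {poly R}).

Definition selfadjoint x := star x = x.

Lemma selfadjoint_normal x : selfadjoint x -> normal_element x.
Proof. by rewrite /normal_element => ->. Qed.

Lemma selfadjoint_starM x : selfadjoint (star x * x).
Proof. by rewrite /selfadjoint starMr starK. Qed.

Lemma selfadjoint_re x : selfadjoint (x + star x).
Proof. by rewrite /selfadjoint starD starK addrC. Qed.

(** This element is minus twice the imaginary part of [x]. *)
Lemma selfadjoint_im x : selfadjoint ('i *: (x - star x)).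
Proof.
rewrite /selfadjoint starZc starD starN starK -[star x - x]opprB scalerN -scaleNr.
by congr (_ *: _); apply/eqP; rewrite eq_complex /= !oppr0 opprK !eqxx.
Qed.

Lemma selfadjointD x y : selfadjoint x -> selfadjoint y -> selfadjoint (x + y).
Proof. by rewrite /selfadjoint starD => -> ->. Qed.

Lemma selfadjointZ r x : selfadjoint x -> selfadjoint (r%:C *: x).
Proof. by rewrite /selfadjoint starZr => ->. Qed.

Lemma selfadjoint1 : selfadjoint (1 : A).
Proof. exact: star1. Qed.

Lemma scale_i_i x : 'i *: ('i *: x) = - x.
Proof. by rewrite scalerA -expr2 sqr_i scaleN1r. Qed.

Lemma star_mul_cartesian x y : selfadjoint x -> selfadjoint y ->
  GRing.comm x y -> star (x + 'i *: y) * (x + 'i *: y) = x ^+ 2 + y ^+ 2.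
Proof.
rewrite /selfadjoint starD starZc => -> -> xy.
have -> : conjc 'i = - 'i :> R[i] by apply/eqP; rewrite eq_complex /= oppr0 !eqxx.
rewrite scaleNr mulrDr !mulrDl !mulNr -!scalerAl -!scalerAr scale_i_i opprK xy.
by rewrite addrA subrK !expr2.
Qed.

Lemma sqr_rnorm_cartesian x y : selfadjoint x -> selfadjoint y ->
  GRing.comm x y -> rnorm (x + 'i *: y) ^+ 2 = rnorm (x ^+ 2 + y ^+ 2).
Proof. by move=> sx sy xy; rewrite -rnorm_starM star_mul_cartesian. Qed.

(** Exhibits [x^* x + x x^*], up to a factor, as a sum of squares of self-adjoint elements. *)
Lemma sqr_cartesian x :
  (x + star x) ^+ 2 + ('i *: (x - star x)) ^+ 2 = (star x * x + x * star x) *+ 2.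
Proof.
rewrite [('i *: _) ^+ 2]expr2 -scalerAl -scalerAr scale_i_i expr2.
set y := star x; set Q := y * x + x * y; set P := x * x + y * y.
have -> : (x + y) * (x + y) = P + Q.
  by rewrite mulrDr !mulrDl [x * y + _ in LHS]addrC addrACA.
have -> : (x - y) * (x - y) = P - Q.
  by rewrite mulrDr !mulrDl !mulrN !mulNr opprK [- (x * y) + _]addrC addrACA -opprD.
by rewrite opprB [P + Q]addrC addrACA subrr addr0 mulr2n.
Qed.

(** Real polynomial calculus at [h]: values commute, and identities between them can be proved by
    [ring] in [{poly R}] although [A] is noncommutative. *)
Definition peval h p : A := horner_alg h (map_poly (real_complex R) p).

Lemma pevalD h p q : peval h (p + q) = peval h p + peval h q.
Proof. by rewrite /peval !rmorphD. Qed.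

Lemma pevalM h p q : peval h (p * q) = peval h p * peval h q.
Proof. by rewrite /peval !rmorphM. Qed.

Lemma pevalCM h r p : peval h (r%:P * p) = r%:C *: peval h p.
Proof. by rewrite pevalM /peval map_polyC /= horner_algC -scalerAl mul1r. Qed.

Lemma peval1 h : peval h 1 = 1.
Proof. by rewrite /peval !rmorph1. Qed.

Lemma pevalXn h p n : peval h (p ^+ n) = peval h p ^+ n.
Proof. by rewrite /peval !rmorphXn. Qed.

Lemma pevalX h : peval h 'X = h.
Proof. by rewrite /peval map_polyX horner_algX. Qed.

Lemma peval_comm h p q : GRing.comm (peval h p) (peval h q).
Proof. by rewrite /GRing.comm -!pevalM mulrC. Qed.

Lemma peval_selfadjoint h p : selfadjoint h -> selfadjoint (peval h p).
Proof.
move=> sh; elim/poly_ind: p => [|p c IH].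
  by rewrite /peval /selfadjoint !rmorph0 star0.
rewrite pevalD; apply: selfadjointD.
  rewrite /selfadjoint pevalM starMr IH pevalX sh.
  by have := peval_comm h 'X p; rewrite pevalX.
by rewrite -[c%:P]mulr1 pevalCM peval1; apply/selfadjointZ/selfadjoint1.
Qed.

Section State.
Variable f : {linear A -> R[i]^o}.
Hypothesis sf : states f.

Definition state_re x : R := complex.Re (f x).

Lemma state_reD x y : state_re (x + y) = state_re x + state_re y.
Proof. by rewrite /state_re linearD; case: (f x) (f y) => ? ? []. Qed.

Lemma state_reZ r x : state_re (r%:C *: x) = r * state_re x.
Proof. by rewrite /state_re linearZ; case: (f x) => u v /=; ring. Qed.

Lemma state_reN x : state_re (- x) = - state_re x.
Proof. by rewrite /state_re linearN; case: (f x). Qed.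

Lemma state_re1 : state_re 1 = 1.
Proof. by rewrite /state_re state1. Qed.

Lemma state_re_le x : state_re x <= rnorm x.
Proof. exact: le_trans (Re_le_rnorm _) (state_le x sf). Qed.

(** For real [t], [|f (h + i t)|^2 <= |h|^2 + t^2]; the left side contains [2 y t], which is
    unbounded unless the imaginary part [y] vanishes. *)
Lemma state_Im0 h : selfadjoint h -> complex.Im (f h) = 0.
Proof.
move=> sh; apply/eqP/negPn/negP => y0.
set y := complex.Im (f h) in y0; set x := complex.Re (f h).
have bound t : x ^+ 2 + (y + t) ^+ 2 <= rnorm h ^+ 2 + t ^+ 2.
  have := state_le (h + 'i *: (t%:C *: 1)) sf.
  rewrite -(@ler_pXn2r _ 2) ?nnegrE ?rnorm_ge0// sqr_rnorm_cartesian//; last 2 first.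
  - exact/selfadjointZ/selfadjoint1.
  - by rewrite /GRing.comm -scalerAl -scalerAr mulr1 mul1r.
  rewrite sqr_rnormC linearD !linearZ /= state1// => le1.
  have -> : x ^+ 2 + (y + t) ^+ 2 = complex.Re (f h + 'i *: (t%:C *: 1)) ^+ 2 +
      complex.Im (f h + 'i *: (t%:C *: 1)) ^+ 2.
    by rewrite /x /y; case: (f h) => u v /=; ring.
  apply: le_trans le1 _; apply: le_trans (ler_rnormD _ _) _.
  apply: lerD; first exact: rnormX_le.
  by rewrite exprZn expr1n -rmorphXn rnormZ rnorm1 mulr1 rnorm_real ger0_norm ?sqr_ge0.
(* This [t] makes [2 y t = |h|^2 + 1]. *)
have := bound ((rnorm h ^+ 2 + 1) / (2 * y)).
have -> : (y + (rnorm h ^+ 2 + 1) / (2 * y)) ^+ 2 =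
    y ^+ 2 + (rnorm h ^+ 2 + 1) + ((rnorm h ^+ 2 + 1) / (2 * y)) ^+ 2 by field.
have := sqr_ge0 x; have := sqr_ge0 y; lra.
Qed.

Lemma state_star x : f (star x) = conjc (f x).
Proof.
have := state_Im0 (selfadjoint_re x); have := state_Im0 (selfadjoint_im x).
rewrite linearZ /= !linearD linearN /=.
case: (f x) => u v; case: (f (star x)) => u' v' /= h1 h2.
by apply/eqP; rewrite eq_complex /=; apply/andP; split; apply/eqP; lra.
Qed.

(* With [u = 1 - (t^2/2) h^2 + i t h] one has [u^* u = 1 + (t^4/4) h^4], so that
   [Re f u <= |u|] bounds [- f (h^2)] by [O(t^2)]. *)
Lemma state_sqr_ge0 h : selfadjoint h -> 0 <= state_re (h ^+ 2).
Proof.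
move=> sh; rewrite leNgt; apply/negP => neg.
pose N := rnorm h ^+ 4; have N0 : 0 <= N by rewrite exprn_ge0 ?rnorm_ge0.
set g := state_re _ in neg.
(* Chosen so that [t^2 (N + 1) = - 2 g]: the error [t^4 N / 4] is then smaller than the gain
   [- t^2 g]. *)
pose t := Num.sqrt (- 2 * g / (N + 1)).
have tt : t ^+ 2 = - 2 * g / (N + 1) by rewrite sqr_sqrtr// divr_ge0//; lra.
have tt0 : 0 < t ^+ 2 by rewrite tt divr_gt0//; lra.
pose px := 1 - (t ^+ 2 / 2)%:P * 'X ^+ 2 : {poly R}; pose py := t%:P * 'X : {poly R}.
have := sqr_rnorm_cartesian (peval_selfadjoint px sh) (peval_selfadjoint py sh)
  (peval_comm _ _ _).
rewrite -!pevalXn -pevalD.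
have -> : px ^+ 2 + py ^+ 2 = 1 + (t ^+ 2 * t ^+ 2 / 4)%:P * 'X ^+ 4.
  have -> : (t ^+ 2 * t ^+ 2 / 4)%:P = (t ^+ 2 / 2)%:P * (t ^+ 2 / 2)%:P :> {poly R}.
    by rewrite -polyCM; congr _%:P; field.
  have tE : t%:P * t%:P = (t ^+ 2 / 2)%:P + (t ^+ 2 / 2)%:P :> {poly R}.
    by rewrite -polyCM -polyCD; congr _%:P; field.
  rewrite /px /py; set T := (t ^+ 2 / 2)%:P in tE *.
  have -> : (t%:P * 'X) ^+ 2 = (T + T) * 'X ^+ 2 by rewrite -tE; ring.
  ring.
have -> : peval h (1 + (t ^+ 2 * t ^+ 2 / 4)%:P * 'X ^+ 4) =
    1 + (t ^+ 2 * t ^+ 2 / 4)%:C *: h ^+ 4.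
  by rewrite pevalD pevalCM peval1 pevalXn pevalX.
move=> uE.
set u := _ + 'i *: _ in uE.
have u_le : rnorm u ^+ 2 <= 1 + t ^+ 2 * t ^+ 2 / 4 * N.
  rewrite uE; apply: le_trans (ler_rnormD _ _) _; rewrite rnorm1 lerD2l rnormZ rnorm_real.
  have c0 : 0 <= t ^+ 2 * t ^+ 2 / 4 by rewrite divr_ge0// mulr_ge0// ltW.
  by rewrite ger0_norm// ler_wpM2l// rnormX_le.
have fu : complex.Re (f u) = 1 - t ^+ 2 / 2 * g.
  rewrite /u -/(state_re _) state_reD.
  have -> : state_re ('i *: peval h py) = 0.
    rewrite /state_re linearZ /=.
    have := state_Im0 (peval_selfadjoint py sh).
    by case: (f _) => a b /= ->; ring.
  rewrite addr0 pevalD -mulNr -polyCN pevalCM peval1 state_reD state_re1.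
  by rewrite state_reZ pevalXn pevalX -/g; ring.
have fu_le : complex.Re (f u) ^+ 2 <= rnorm u ^+ 2.
  rewrite -[leLHS]real_normK ?num_real// ler_pXn2r ?nnegrE ?rnorm_ge0//.
  exact: le_trans (normr_Re_le _) (state_le _ sf).
have := le_trans fu_le u_le; rewrite fu.
set s := t ^+ 2 in tt tt0 *.
have sN : s * (N + 1) = - 2 * g by rewrite tt divfK ?gt_eqF//; lra.
nra.
Qed.

Lemma state_CauchySchwarz_peval h p q : selfadjoint h ->
  state_re (peval h (p * q)) ^+ 2 <=
  state_re (peval h (p ^+ 2)) * state_re (peval h (q ^+ 2)).
Proof.
move=> sh; set a := state_re (peval h (p ^+ 2)).
set b := state_re (peval h (p * q)); set d := state_re (peval h (q ^+ 2)).
have quad c : 0 <= c ^+ 2 * a + 2 * c * b + d.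
  have := state_sqr_ge0 (peval_selfadjoint (c%:P * p + q) sh).
  have -> : peval h (c%:P * p + q) ^+ 2 =
      (c * c)%:C *: peval h (p ^+ 2) + (c + c)%:C *: peval h (p * q) + peval h (q ^+ 2).
    rewrite -pevalXn -!pevalCM -!pevalD; congr peval.
    by rewrite polyCM polyCD; ring.
  by rewrite !state_reD !state_reZ -/a -/b -/d; lra.
have a0 : 0 <= a by rewrite /a pevalXn; exact/state_sqr_ge0/peval_selfadjoint.
have [az|an0] := eqVneq a 0.
  have [->|b0] := eqVneq b 0; first by rewrite az expr0n mul0r.
  (* Without its leading term the quadratic takes the value -1 here. *)
  have := quad (- (d + 1) / (2 * b)); rewrite az.
  have -> : 2 * (- (d + 1) / (2 * b)) * b = - (d + 1) by field.
  lra.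
(* The minimizer of the quadratic. *)
have := quad (- b / a).
have -> : (- b / a) ^+ 2 * a + 2 * (- b / a) * b + d = d - b ^+ 2 / a by field.
by rewrite subr_ge0 ler_pdivrMr ?lt0r ?an0// mulrC.
Qed.

(* Cauchy-Schwarz gives [r q ^ 2 <= r (q ^ 2)] for [r q := f (p ^ 2 q) / f (p ^ 2)],
   so the powers [r q ^ (2 ^ n)] are bounded. *)
Lemma state_peval_le h p q : selfadjoint h -> rnorm (peval h q) <= 1 ->
  state_re (peval h (p ^+ 2 * q)) <= state_re (peval h (p ^+ 2)).
Proof.
move=> sh; set s := state_re (peval h (p ^+ 2)).
have s0 : 0 <= s by rewrite /s pevalXn; exact/state_sqr_ge0/peval_selfadjoint.
have step (r : {poly R}) : state_re (peval h (p ^+ 2 * r)) ^+ 2 <=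
    s * state_re (peval h (p ^+ 2 * r ^+ 2)).
  have := state_CauchySchwarz_peval p (p * r) sh.
  by rewrite exprMn mulrA -expr2.
have [sz _|sn0] := eqVneq s 0.
  have := step q; rewrite sz mul0r => h1.
  by nra.
have sp : 0 < s by rewrite lt0r sn0.
move=> q1; rewrite -[leRHS]mul1r -ler_pdivrMr//.
apply: (@exp2_bounded_le1 _ _ (rnorm (peval h (p ^+ 2)) / s)) => n.
elim: n q q1 => [|n IH] q q1.
  rewrite expn0 expr1 ler_pM2r ?invr_gt0//; apply: le_trans (state_re_le _) _.
  by rewrite pevalM (le_trans (rnormM_le _ _))// ler_piMr ?rnorm_ge0.
have q21 : rnorm (peval h (q ^+ 2)) <= 1.
  by rewrite pevalXn (le_trans (rnormX_le _ _))// expr_le1 ?rnorm_ge0.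
apply: le_trans (IH _ q21); rewrite expnS exprM.
have h1 : (state_re (peval h (p ^+ 2 * q)) / s) ^+ 2 <=
    state_re (peval h (p ^+ 2 * q ^+ 2)) / s.
  have := step q; set u := state_re _; set v := state_re (peval h (p ^+ 2 * q ^+ 2)).
  rewrite exprMn exprVn ler_pdivrMr ?exprn_gt0//.
  by have -> : v / s * s ^+ 2 = s * v by field.
by rewrite lerXn2r ?nnegrE ?sqr_ge0// (le_trans (sqr_ge0 _) h1).
Qed.

Lemma state_shift_peval_ge0 h p : selfadjoint h -> rnorm h <= 1 ->
  0 <= state_re (peval h (p ^+ 2 * (1 - 'X))).
Proof.
move=> sh h1; have := @state_peval_le h p 'X sh.
rewrite pevalX mulrBr mulr1 => /(_ h1); rewrite pevalD.
have -> : peval h (- (p ^+ 2 * 'X)) = - peval h (p ^+ 2 * 'X).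
  by rewrite /peval !rmorphN.
by rewrite state_reD state_reN subr_ge0.
Qed.

(* [t (1 - t)^(2k)] is at most [1/(2k)] on [[-1, 1]], by Bernoulli's inequality
   [(1 + 2k t) (1 - t)^(2k) <= 1]. *)
Lemma state_cutoff_le h k : selfadjoint h -> rnorm h <= 1 ->
  (k * 2)%:R * state_re (peval h ('X * (1 - 'X) ^+ (k * 2))) <= 1.
Proof.
move=> sh h1; pose y : {poly R} := 1 - 'X.
have sq p : 0 <= state_re (peval h (p ^+ 2)).
  by rewrite pevalXn; exact/state_sqr_ge0/peval_selfadjoint.
suff : state_re (peval h ((1 + (k * 2)%:R%:P * 'X) * y ^+ (k * 2))) <= 1.
  have := sq (y ^+ k); rewrite -exprM => y0.
  by rewrite mulrDl mul1r -mulrA pevalD pevalCM state_reD state_reZ; lra.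
elim: k => [|k IH].
  by rewrite mul0n mul0r addr0 expr0 mulr1 peval1 state_re1.
apply: le_trans IH.
(* Bernoulli's induction step as an identity: the difference of consecutive terms is a square plus a
   square times [1 - X], with nonnegative coefficients. *)
have -> : (1 + (k * 2)%:R%:P * 'X) * y ^+ (k * 2) =
   (1 + (k.+1 * 2)%:R%:P * 'X) * y ^+ (k.+1 * 2) +
   ((k * 2).+1%:R%:P * ('X * y ^+ k) ^+ 2 + (k.+1 * 2)%:R%:P * (('X * y ^+ k) ^+ 2 * y)).
  have -> : (k.+1 * 2)%:R%:P = (k * 2)%:R%:P + 1 + 1 :> {poly R}.
    by rewrite mulSn addnC !natrD !polyCD addrA.
  have -> : (k * 2).+1%:R%:P = (k * 2)%:R%:P + 1 :> {poly R}.
    by rewrite -natr1 polyCD.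
  by rewrite mulSn exprD exprM /y; ring.
rewrite pevalD state_reD lerDl pevalD !pevalCM state_reD !state_reZ.
by apply: addr_ge0; apply: mulr_ge0 => //; exact: state_shift_peval_ge0.
Qed.

(** With [y = 1 - t], [t y^(2k) - t y^(2k+2) = (t y^k)^2 (1 + y)]. Hence a negative value of [f h]
    survives the cutoff. *)
Lemma state_cutoff_ge h k : selfadjoint h -> rnorm h <= 1 ->
  state_re (peval h ('X * (1 - 'X) ^+ (k * 2))) <= state_re h.
Proof.
move=> sh h1; pose y : {poly R} := 1 - 'X; rewrite -/y.
elim: k => [|k IH]; first by rewrite mul0n expr0 mulr1 pevalX.
apply: le_trans IH.
have -> : 'X * y ^+ (k * 2) =
   'X * y ^+ (k.+1 * 2) + (('X * y ^+ k) ^+ 2 + ('X * y ^+ k) ^+ 2 * y).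
  by rewrite mulSn exprD exprM /y; ring.
rewrite pevalD state_reD lerDl pevalD state_reD; apply: addr_ge0.
  by rewrite pevalXn; exact/state_sqr_ge0/peval_selfadjoint.
exact: state_shift_peval_ge0.
Qed.

End State.
End SelfAdjoint.

(** * Positivity of states *)

Section Positivity.
Local Open Scope complex_scope.
Variables (R : realType) (A : cstarAlgType R).
Implicit Types (a h x y : A) (k : nat) (r t M : R) (f : {linear A -> R[i]^o}).

(** States nearly attain the norm of a normal element, and their values at [x] are real. *)
Lemma selfadjoint_rnorm_le x c : selfadjoint x ->
  (forall f, states f -> `|state_re f x| <= c) -> rnorm x <= c.
Proof.
move=> sx xc; apply/ler_addgt0Pr => e e0.
have [f sf] := normal_state_gt (selfadjoint_normal sx) e0.
have -> : rnorm (f x) = `|state_re f x|.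
  by rewrite rnormC (state_Im0 sf sx) expr0n addr0 sqrtr_sqr.
by have := xc f sf; lra.
Qed.

Lemma state_re_star_sum_ge0 f x : states f ->
  0 <= state_re f (star x * x) + state_re f (x * star x).
Proof.
move=> sf; have h1 := state_sqr_ge0 sf (selfadjoint_re x).
have h2 := state_sqr_ge0 sf (selfadjoint_im x).
have := congr1 (state_re f) (sqr_cartesian x).
by rewrite mulr2n !state_reD; lra.
Qed.

(* Kaplansky's argument: [x^* x] and [x x^*] have the same norm [M], their sum
   is positive, and [(x x^* + M) x x^* = x (x^* x + M) x^*]. If [x^* x <= e]
   with [e] small, then [x x^* >= -e], so its norm is attained at the top of its
   numerical range and the left side has norm about [2 M^2], while the right
   side has norm at most [M (M + e)]. *)
Lemma not_almost_negative_starM x e : 0 < rnorm x -> e <= rnorm x ^+ 2 / 8 ->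
  ~ (forall f, states f -> state_re f (star x * x) <= e).
Proof.
move=> x0 eM Be; set M := rnorm x ^+ 2 in eM.
have M0 : 0 < M by rewrite exprn_gt0.
pose B := star x * x; pose C := x * star x.
have sB : selfadjoint B := selfadjoint_starM x.
have sC : selfadjoint C by rewrite /selfadjoint starMr starK.
have nB : rnorm B = M := rnorm_starM x.
have nC : rnorm C = M by rewrite /C -{1}[x]starK rnorm_starM rnorm_star.
(* Since [f B >= - |B| = - M], the shift by [M] makes every state value nonnegative. *)
have BM : rnorm (B + M%:C *: 1) <= M + e.
  apply: selfadjoint_rnorm_le => [|f sf].
    exact: selfadjointD sB (selfadjointZ _ (selfadjoint1 A)).
  rewrite state_reD state_reZ state_re1// mulr1 ger0_norm.
    by rewrite addrC lerD2l; exact: Be.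
  have := state_re_le sf (- B); rewrite state_reN rnormN nB; lra.
have Ce f : states f -> - e <= state_re f C.
  move=> sf; have := state_re_star_sum_ge0 x sf; have := Be f sf.
  by rewrite -/B -/C; lra.
have M80 : 0 < M / 8 by lra.
have [f sf] := normal_state_gt (selfadjoint_normal sC) M80.
have -> : rnorm (f C) = `|state_re f C|.
  by rewrite rnormC (state_Im0 sf sC) expr0n addr0 sqrtr_sqr.
rewrite nC => fC; set c := state_re f C in fC.
(* A negative [c] would have modulus at most [e <= M / 8]. *)
have c_ge : M - M / 8 < c.
  have := Ce f sf; rewrite -/c; move: fC; case: (ler0P c) => _; lra.
have up : rnorm ((C + M%:C *: 1) * C) <= M * (M + e).
  have -> : (C + M%:C *: 1) * C = x * (B + M%:C *: 1) * star x.
    rewrite mulrDl mulrDr mulrDl /C /B !mulrA -!scalerAl mul1r.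
    by rewrite -scalerAr mulr1 -scalerAl.
  have h1 := rnormM_le (x * (B + M%:C *: 1)) (star x).
  have h2 := ler_wpM2r (rnorm_ge0 (star x)) (rnormM_le x (B + M%:C *: 1)).
  have h3 := ler_wpM2l (ltW M0) BM.
  apply: le_trans h1 _; apply: le_trans h2 _; apply: le_trans h3.
  by rewrite rnorm_star /M; rewrite le_eqVlt; apply/orP; left; apply/eqP; ring.
have := le_trans (state_re_le sf _) up.
rewrite mulrDl state_reD -scalerAl mul1r state_reZ -expr2 -/c.
(* As [f (C^2) >= c^2], one gets [c^2 + M c <= M (M + e) <= 9/8 M^2], while [c > 7/8 M] makes the
   left side exceed [105/64 M^2]. *)
have := state_CauchySchwarz_peval sf 'X 1 sC.
rewrite mulr1 expr1n peval1 state_re1// mulr1 pevalXn pevalX -/c.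
nra.
Qed.

(** Suppose [f b = d < 0] for [b = a^* a]. With [x = a (1 - b)^k], the element
    [x^* x = b (1 - b)^(2k)] is at most [1/(2k)] under every state, yet has norm at least [- d],
    against Kaplansky's argument. *)
Lemma state_starM_ge0 f a : states f -> 0 <= state_re f (star a * a).
Proof.
move=> sf; have [->|a0] := eqVneq a 0.
  by rewrite mulr0 /state_re linear0.
have ap : 0 < rnorm a by rewrite lt0r rnorm_eq0 a0 rnorm_ge0.
wlog a1 : a a0 ap / rnorm a = 1.
  pose r := (rnorm a)^-1; have r0 : 0 < r by rewrite invr_gt0.
  have n1 : rnorm (r%:C *: a) = 1.
    by rewrite rnormZ rnorm_real gtr0_norm// mulVf// gt_eqF.
  move=> /(_ (r%:C *: a)); rewrite -rnorm_eq0 n1 oner_neq0 => /(_ isT ltr01 erefl).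
  rewrite starZr -scalerAl -scalerAr !state_reZ mulrA pmulr_rge0//.
  by rewrite mulr_gt0.
rewrite leNgt; apply/negP; set d := state_re f _ => d0.
pose b := star a * a; have sb : selfadjoint b := selfadjoint_starM a.
have b1 : rnorm b <= 1 by rewrite rnorm_starM a1 expr1n.
(* This gives [1/(2k) <= - d / 8 <= |x|^2 / 8]. *)
have [k hk] := exists_natr_gt (4 / - d).
have k0 : 0 < k%:R :> R by apply: lt_trans hk; rewrite divr_gt0//; lra.
pose Y := peval b ((1 - 'X) ^+ k); pose x := a * Y.
have sY : star Y = Y by exact: peval_selfadjoint.
have xE : star x * x = peval b ('X * (1 - 'X) ^+ (k * 2)).
  rewrite exprM expr2 mulrCA !pevalM pevalX -/Y.
  by rewrite starMr sY /b !mulrA.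
have xd : - d <= rnorm x ^+ 2.
  rewrite -rnorm_starM xE; have := state_cutoff_ge sf k sb b1; rewrite -/b -/d.
  set B := peval _ _ => Bd; have := state_re_le sf (- B).
  by rewrite state_reN rnormN; lra.
have x0 : 0 < rnorm x.
  rewrite lt0r rnorm_ge0 andbT; apply/eqP => z; move: xd; rewrite z expr0n /=; lra.
apply: (@not_almost_negative_starM x ((k * 2)%:R^-1) x0).
  have : (k * 2)%:R^-1 <= - d / 8.
    rewrite ltr_pdivrMr in hk; last lra.
    by rewrite natrM -div1r ler_pdivrMr; lra.
  lra.
move=> g sg; rewrite xE -[leRHS]mulr1 ler_pdivlMl; last by rewrite natrM; lra.
exact: state_cutoff_le.
Qed.

(** The variance [f ((a - f a)^* (a - f a)) = f (a^* a) - |f a|^2] is nonnegative. *)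
Lemma state_CauchySchwarz f a : states f ->
  rnorm (f a) ^+ 2 <= state_re f (star a * a).
Proof.
move=> sf; have := state_starM_ge0 (a - f a *: 1) sf.
have -> : star (a - f a *: 1) * (a - f a *: 1) =
    star a * a - conjc (f a) *: a + (- (f a *: star a) + (conjc (f a) * f a) *: 1).
  rewrite starD starN starZc star1 mulrDr !mulrDl !mulNr !mulrN.
  by rewrite -!scalerAl -!scalerAr mulr1 !mul1r scalerA opprK.
rewrite /state_re !linearD !linearN !linearZ /= (state_star sf) state1//.
rewrite sqr_rnormC; case: (f a) (f (star a * a)) => u v [u' v'] /=; lra.
Qed.

Lemma state_starM_le f a : states f -> state_re f (star a * a) <= rnorm a ^+ 2.
Proof. by move=> sf; rewrite -rnorm_starM; exact: state_re_le. Qed.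

End Positivity.

(** * Mean norms *)

Section MeanNorm.
Local Open Scope complex_scope.
Variables (R : realType) (A : cstarAlgType R).
Implicit Types (a : A) (k : R[i]) (s : R -> R -> R) (f : {linear A -> R[i]^o}).

Lemma numerical_radius_le a c :
  (forall f, states f -> rnorm (f a) <= c) -> numerical_radius a <= c.
Proof.
move=> fc; apply: ge_sup; last by move=> _ [f sf <-]; exact: fc.
by have [f sf _] := exists_state a; exists (rnorm (f a)), f.
Qed.

Lemma le_numerical_radius a f : states f -> rnorm (f a) <= numerical_radius a.
Proof.
move=> sf; apply: ub_le_sup; last by exists f.
by exists (rnorm a) => _ [g sg <-]; exact: state_le.
Qed.

Lemma numerical_radius_ge0 a : 0 <= numerical_radius a.
Proof.
have [f sf _] := exists_state a.
exact: le_trans (rnorm_ge0 _) (le_numerical_radius a sf).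
Qed.

Lemma normal_numerical_radius a : normal_element a -> numerical_radius a = rnorm a.
Proof.
move=> na; apply/eqP; rewrite eq_le numerical_radius_le/=; last first.
  by move=> f sf; exact: state_le.
apply/ler_addgt0Pr => e e0; have [f sf] := normal_state_gt na e0.
by have := le_numerical_radius a sf; lra.
Qed.

Lemma numerical_radius_eq0 a : numerical_radius a = 0 -> a = 0.
Proof.
move=> v0; have fa0 f : states f -> f a = 0.
  move=> sf; apply/eqP; rewrite -rnorm_eq0 eq_le rnorm_ge0 andbT -v0.
  exact: le_numerical_radius.
have sa0 x : selfadjoint x -> (forall f, states f -> f x = 0) -> x = 0.
  move=> sx fx0; apply/eqP; rewrite -rnorm_eq0 eq_le rnorm_ge0 andbT.
  by apply: selfadjoint_rnorm_le => // f sf; rewrite /state_re fx0// normr0.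
have re0 : a + star a = 0.
  apply: sa0 => [|f sf]; first exact: selfadjoint_re.
  by rewrite linearD (state_star sf) fa0// conjc0 addr0.
have im0 : 'i *: (a - star a) = 0.
  apply: sa0 => [|f sf]; first exact: selfadjoint_im.
  by rewrite linearZ /= linearB (state_star sf) fa0// conjc0 subr0 scaler0.
have aa : a = - a.
  have := congr1 (fun x => - ('i *: x)) im0.
  rewrite scale_i_i opprK scaler0 oppr0 => /subr0_eq ae.
  by apply/eqP; rewrite -addr_eq0 {2}ae re0.
apply/eqP; have : (2 : R[i]) *: a == 0 by rewrite scaler_nat mulr2n {1}aa addNr.
by rewrite scaler_eq0 pnatr_eq0.
Qed.

Section Mean.
Variable s : R -> R -> R.
Hypothesis ms : mean s.

Let val a f := Num.sqrt (s (rnorm (f a) ^+ 2) (state_re f (star a * a))).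

(** Betweenness of a mean is stated for ordered arguments; Cauchy-Schwarz supplies the order
    [|f a|^2 <= f (a^* a)]. *)
Lemma mean_norm_state_ge a f : states f -> rnorm (f a) <= val a f.
Proof.
move=> sf; have /andP[h _] :=
  mean_between ms (sqr_ge0 (rnorm (f a))) (state_CauchySchwarz a sf).
by rewrite -[leLHS]ger0_norm ?rnorm_ge0// -sqrtr_sqr ler_wsqrtr.
Qed.

Lemma mean_norm_state_le a f : states f -> val a f <= rnorm a.
Proof.
move=> sf; have /andP[_ h] :=
  mean_between ms (sqr_ge0 (rnorm (f a))) (state_CauchySchwarz a sf).
rewrite -[leRHS]ger0_norm ?rnorm_ge0// -sqrtr_sqr ler_wsqrtr//.
exact: le_trans h (state_starM_le a sf).
Qed.

Lemma mean_norm_le a c : (forall f, states f -> val a f <= c) -> mean_norm s a <= c.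
Proof.
move=> fc; apply: ge_sup; last by move=> _ [f sf <-]; exact: fc.
by have [f sf _] := exists_state a; exists (val a f), f.
Qed.

Lemma le_mean_norm a f : states f -> val a f <= mean_norm s a.
Proof.
move=> sf; apply: ub_le_sup; last by exists f.
by exists (rnorm a) => _ [g sg <-]; exact: mean_norm_state_le.
Qed.

Lemma numerical_radius_le_mean_norm a : numerical_radius a <= mean_norm s a.
Proof.
apply: numerical_radius_le => f sf.
exact: le_trans (mean_norm_state_ge a sf) (le_mean_norm a sf).
Qed.

Lemma mean_norm_le_rnorm a : mean_norm s a <= rnorm a.
Proof. by apply: mean_norm_le => f; exact: mean_norm_state_le. Qed.

Lemma mean_norm_eq0 a : mean_norm s a = 0 <-> a = 0.
Proof.
split=> [m0|->].
  apply: numerical_radius_eq0; apply/eqP.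
  by rewrite eq_le numerical_radius_ge0 andbT -m0 numerical_radius_le_mean_norm.
apply/eqP; rewrite eq_le -{1}(rnorm0 A) mean_norm_le_rnorm.
exact: le_trans (numerical_radius_ge0 _) (numerical_radius_le_mean_norm _).
Qed.

(** Homogeneity of the mean with the positive factor [|k|^2]; the reverse inequality follows by
    applying this to [k^-1]. *)
Lemma mean_normZ_le k a : k != 0 -> mean_norm s (k *: a) <= rnorm k * mean_norm s a.
Proof.
move=> k0; apply: mean_norm_le => f sf; rewrite /val.
have kp : 0 < rnorm k by rewrite lt0r rnorm_eq0 k0 rnorm_ge0.
have -> : rnorm (f (k *: a)) ^+ 2 = rnorm k ^+ 2 * rnorm (f a) ^+ 2.
  by rewrite linearZ /= rnormCM exprMn.
have -> : state_re f (star (k *: a) * (k *: a)) = rnorm k ^+ 2 * state_re f (star a * a).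
  rewrite starZc -scalerAl -scalerAr scalerA -state_reZ; congr (state_re f (_ *: _)).
  rewrite sqr_rnormC; case: k {k0 kp} => u v; apply/eqP; rewrite eq_complex /=.
  by apply/andP; split; apply/eqP; ring.
rewrite (mean_homogeneous ms) ?exprn_gt0 ?sqr_ge0//; last exact: state_starM_ge0.
rewrite sqrtrM ?sqr_ge0// sqrtr_sqr ger0_norm ?rnorm_ge0// ler_pM2l//.
exact: le_mean_norm.
Qed.

Lemma mean_normZ k a : mean_norm s (k *: a) = rnorm k * mean_norm s a.
Proof.
have [->|k0] := eqVneq k 0.
  by rewrite scale0r rnorm0 mul0r; apply/mean_norm_eq0.
apply/eqP; rewrite eq_le mean_normZ_le//=.
have kp : 0 < rnorm k by rewrite lt0r rnorm_eq0 k0 rnorm_ge0.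
have ki0 : k^-1 != 0 by rewrite invr_eq0.
have := mean_normZ_le (k *: a) ki0; rewrite scalerA mulVf// scale1r => le1.
have := ler_wpM2l (ltW kp) le1; rewrite mulrA -rnormCM divff//.
by rewrite (rnorm_real 1) normr1 mul1r.
Qed.

Lemma normal_mean_norm a : normal_element a -> mean_norm s a = rnorm a.
Proof.
move=> na; apply/eqP; rewrite eq_le mean_norm_le_rnorm.
by rewrite -normal_numerical_radius ?numerical_radius_le_mean_norm.
Qed.

End Mean.
End MeanNorm.

Theorem proposition2p1 (R : realType) (A : cstarAlgType R) (a : A)
    (sigma : R -> R -> R) (sg : R -> R -> R -> R)
    (sigma_sym : symmetric_mean sigma)
    (sg_path : interpolation_path sigma sg) :
  (mean_norm (sg 0) a = numerical_radius a /\ mean_norm (sg 1) a = rnorm a) /\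
  (forall mu, 0 <= mu <= 1 ->
     numerical_radius a <= mean_norm (sg mu) a <= rnorm a) /\
  (forall mu, 0 <= mu <= 1 ->
     mean_norm (sg mu) a <=
       Num.sqrt (sg mu (numerical_radius a ^+ 2) (rnorm a ^+ 2))) /\
  (forall mu, 0 <= mu <= 1 -> (mean_norm (sg mu) a = 0 <-> a = 0)) /\
  (forall (lambda : R[i]) mu, 0 <= mu <= 1 ->
     mean_norm (sg mu) (lambda *: a) = rnorm lambda * mean_norm (sg mu) a) /\
  (normal_element a -> forall mu, 0 <= mu <= 1 ->
     [/\ numerical_radius a = mean_norm (sg mu) a,
         mean_norm (sg mu) a = mean_norm (sg mu) (star a)
       & mean_norm (sg mu) (star a) = rnorm a]).
Proof.
have sgM := path_mean sg_path.
have m0 : mean (sg 0) by apply: sgM; rewrite lexx ler01.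
have m1 : mean (sg 1) by apply: sgM; rewrite ler01 lexx.
refine (conj (conj _ _) (conj _ (conj _ (conj _ (conj _ _))))).
- apply/eqP; rewrite eq_le numerical_radius_le_mean_norm// andbT.
  apply: mean_norm_le => f sf; rewrite (path0 sg_path) ?sqr_ge0 ?state_starM_ge0//.
  by rewrite sqrtr_sqr ger0_norm ?rnorm_ge0// le_numerical_radius.
- apply/eqP; rewrite eq_le mean_norm_le_rnorm//=.
  have mn0 := le_trans (numerical_radius_ge0 a) (numerical_radius_le_mean_norm m1 a).
  (* As [|a|^2 = |a^* a|] and [a^* a] is self-adjoint, it suffices to bound its states. *)
  rewrite -(@ler_pXn2r _ 2) ?nnegrE ?rnorm_ge0// -rnorm_starM.
  apply: selfadjoint_rnorm_le => [|f sf]; first exact: selfadjoint_starM.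
  have f0 := state_starM_ge0 a sf.
  rewrite ger0_norm// -(sqr_sqrtr f0) ler_pXn2r ?nnegrE ?sqrtr_ge0//.
  by have := le_mean_norm m1 a sf; rewrite (path1 sg_path) ?sqr_ge0.
- by move=> mu /sgM mmu; rewrite numerical_radius_le_mean_norm// mean_norm_le_rnorm.
- move=> mu mu01; have mmu := sgM mu mu01; have [incl incr] := mean_increasing mmu.
  apply: mean_norm_le => f sf; apply: ler_wsqrtr.
  (* Raise the arguments one at a time: [|f a|^2] to [v(a)^2], then [f (a^* a)] to [|a|^2]. *)
  apply: (@le_trans _ _ (sg mu (numerical_radius a ^+ 2) (state_re f (star a * a)))).
    apply: incl; rewrite ?sqr_ge0 ?state_starM_ge0//.
    by rewrite ler_pXn2r ?nnegrE ?rnorm_ge0 ?numerical_radius_ge0 ?le_numerical_radius.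
  by apply: incr; rewrite ?sqr_ge0 ?state_starM_ge0 ?state_starM_le.
- by move=> mu /sgM mmu; exact: mean_norm_eq0.
- by move=> k mu /sgM mmu; exact: mean_normZ.
- move=> na mu /sgM mmu.
  have ns : normal_element (star a) by rewrite /normal_element starK; exact: esym.
  by rewrite normal_numerical_radius// !normal_mean_norm// rnorm_star.
Qed.
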